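(* The functor $\mathcal{F}^{\mathrm{OpSet}}_{\mathrm{Set}}$ from sets to operated sets, $X\mapsto(\mathcal{X},P_{\mathcal{X}})$, is left adjoint to the forgetful functor $\mathcal{U}^{\mathrm{OpSet}}_{\mathrm{Set}}$ from operated sets to sets; hence it gives the free operated set generated by a set.
   Context: An operated set is a set $Y$ with a map $P_Y:Y\to Y$; a morphism $(Y,P_Y)\to(W,P_W)$ is a map $f$ with $f\circ P_Y=P_W\circ f$. For a nonempty set $X$, $\lfloor X\rfloor$ denotes the set of formal elements $\lfloor x\rfloor$, $x\in X$. Put $\lfloor X\rfloor^{(0)}=X$, $\lfloor X\rfloor^{(1)}=\lfloor X\rfloor$, $\lfloor X\rfloor^{(n+1)}=\lfloor\lfloor X\rfloor^{(n)}\rfloor$ for $n\ge1$, and let $\lfloor x\rfloor^{(n)}$ be the element of $\lfloor X\rfloor^{(n)}$ corresponding to $x\in X$. Let $\mathcal{X}=\bigsqcup_{n\ge0}\lfloor X\rfloor^{(n)}$ and $P_{\mathcal{X}}(u)=\lfloor u\rfloor$ for $u\in\mathcal{X}$. Set $\mathcal{F}^{\mathrm{OpSet}}_{\mathrm{Set}}(X):=(\mathcal{X},P_{\mathcal{X}})$; for $X=\emptyset$, it is the empty set with its identity map. For a map $f:X\to Y$, $\mathcal{F}^{\mathrm{OpSet}}_{\mathrm{Set}}(f)$ sends $\lfloor x\rfloor^{(n)}$ to $\lfloor f(x)\rfloor^{(n)}$. *)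

(* Defs.v *)
From mathcomp Require Import all_boot.
From mathcomp Require Import boolp.

Set Implicit Arguments.
Unset Strict Implicit.
Unset Printing Implicit Defensive.

(** Categories, functors, adjunctions *)

Record category := Category {
  obj :> Type;
  hom : obj -> obj -> Type;
  idm : forall a, hom a a;
  comp : forall a b c, hom b c -> hom a b -> hom a c;
  comp_idl : forall a b (f : hom a b), comp (idm b) f = f;
  comp_idr : forall a b (f : hom a b), comp f (idm a) = f;
  comp_assoc : forall a b c d (h : hom c d) (g : hom b c) (f : hom a b),
    comp h (comp g f) = comp (comp h g) f
}.

Arguments idm {c0} a : rename.
Arguments comp {c0 a b c} g f : rename.

Record functor (C D : category) := Functor {
  fobj :> C -> D;
  fmap : forall a b : C, hom a b -> hom (fobj a) (fobj b);
  fmap_id : forall a : C, fmap (idm a) = idm (fobj a);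
  fmap_comp : forall (a b c : C) (g : hom b c) (f : hom a b),
    fmap (comp g f) = comp (fmap g) (fmap f)
}.

Arguments fmap {C D} F {a b} f : rename.

(* Bijections hom (F x) y -> hom x (G y), natural in both x and y. *)
Definition left_adjoint (C D : category) (F : functor C D) (G : functor D C)
    : Prop :=
  exists phi : forall (x : C) (y : D), hom (F x) y -> hom x (G y),
    (forall x y, bijective (phi x y)) /\
    (forall (x x' : C) (y y' : D)
            (f : hom x' x) (g : hom y y') (k : hom (F x) y),
       phi x' y' (comp g (comp k (fmap F f)))
         = comp (fmap G g) (comp (phi x y k) f)).

Definition SetCat : category :=
  @Category Type (fun X Y => X -> Y) (fun X x => x)
    (fun X Y Z g f => g \o f)
    (fun _ _ _ => erefl) (fun _ _ _ => erefl) (fun _ _ _ _ _ _ _ => erefl).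

(** Operated sets *)

Record opset := OpSet {
  carrier :> Type;
  op : carrier -> carrier
}.

Arguments op : clear implicits.

Record opmor (Y W : opset) := OpMor {
  opmor_fun :> Y -> W;
  opmorP : {morph opmor_fun : y / op Y y >-> op W y}
}.

Lemma opmor_inj (Y W : opset) (f g : opmor Y W) :
  opmor_fun f = opmor_fun g -> f = g.
Proof.
case: f g => [f fP] [g gP] /= fg; case: _ / fg gP => gP.
by congr OpMor; exact: Prop_irrelevance.
Qed.

Definition opmor_id (Y : opset) : opmor Y Y := @OpMor Y Y id (fun=> erefl).

Lemma opmor_compP (Y W Z : opset) (g : opmor W Z) (f : opmor Y W) :
  {morph g \o f : y / op Y y >-> op Z y}.
Proof. by move=> y /=; rewrite !opmorP. Qed.

Definition opmor_comp (Y W Z : opset) (g : opmor W Z) (f : opmor Y W) :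
  opmor Y Z := OpMor (opmor_compP g f).

Definition OpSetCat : category.
Proof.
refine (@Category opset opmor opmor_id opmor_comp _ _ _).
- by move=> Y W f; exact: opmor_inj.
- by move=> Y W f; exact: opmor_inj.
- by move=> Y W Z T h g f; exact: opmor_inj.
Defined.

Definition U_OpSet : functor OpSetCat SetCat :=
  @Functor OpSetCat SetCat carrier (fun Y W (f : opmor Y W) => opmor_fun f)
    (fun _ => erefl) (fun _ _ _ _ _ => erefl).

(** The operated set of iterated brackets *)

Inductive bracket (X : Type) : Type := Bracket of X.

Fixpoint bracket_iter (n : nat) (X : Type) : Type :=
  if n is m.+1 then bracket (bracket_iter m X) else X.

Fixpoint biter (X : Type) (n : nat) (x : X) : bracket_iter n X :=
  if n is m.+1 then Bracket (biter m x) else x.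

(* The disjoint union of the bracket_iter n X over all n. If X is empty, so
   is bracketed X, and then its operator below is the identity. *)
Definition bracketed (X : Type) : Type := {n : nat & bracket_iter n X}.

Definition bracketed_op (X : Type) (u : bracketed X) : bracketed X :=
  existT (fun n => bracket_iter n X) (projT1 u).+1 (Bracket (projT2 u)).

Definition free_opset (X : Type) : opset := OpSet (@bracketed_op X).

Definition free_incl (X : Type) (x : X) : free_opset X :=
  existT (fun n => bracket_iter n X) 0 x.

Fixpoint bracket_iter_map (X Y : Type) (f : X -> Y) (n : nat) :
    bracket_iter n X -> bracket_iter n Y :=
  if n is m.+1
  then fun u => let: Bracket v := u in Bracket (bracket_iter_map f v)
  else f.

Definition bracketed_map (X Y : Type) (f : X -> Y) (u : bracketed X) :
    bracketed Y :=
  existT (fun n => bracket_iter n Y) (projT1 u) (bracket_iter_map f (projT2 u)).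

Lemma bracketed_map_biter (X Y : Type) (f : X -> Y) (n : nat) (x : X) :
  bracketed_map f (existT _ n (biter n x)) = existT _ n (biter n (f x)).
Proof.
by congr existT => /=; elim: n => //= n ->.
Qed.

Lemma biter_surj (X : Type) (n : nat) (u : bracket_iter n X) :
  exists x, u = biter n x.
Proof.
elim: n u => [|n IHn] /= u; first by exists u.
by case: u => u; have [x ->] := IHn u; exists x.
Qed.

Definition free_opset_map (X Y : Type) (f : X -> Y) :
    opmor (free_opset X) (free_opset Y) :=
  @OpMor (free_opset X) (free_opset Y) (bracketed_map f) (fun=> erefl).

Definition F_OpSet : functor SetCat OpSetCat.
Proof.
refine (@Functor SetCat OpSetCat free_opset free_opset_map _ _).
- move=> X; apply: opmor_inj; apply: funext => -[n u] /=.
  by have [x ->] := biter_surj u; rewrite bracketed_map_biter.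
- move=> X Y Z g f; apply: opmor_inj; apply: funext => -[n u] /=.
  by have [x ->] := biter_surj u; rewrite !bracketed_map_biter.
Defined.

Definition is_free_opset (X : Type) (A : opset) (i : X -> A) : Prop :=
  forall (Y : opset) (f : X -> Y), exists! g : opmor A Y, g \o i = f.

(* Main.v *)
From mathcomp Require Import all_boot.
From mathcomp Require Import boolp.
Require Import Defs.

Set Implicit Arguments.
Unset Strict Implicit.
Unset Printing Implicit Defensive.

(** Every element of the bracketed set arises in exactly one way from some
    [x] in [X] by applying the bracket operator [n] times, so an operated map
    out of it is forced by its values on [X]: [n] brackets around [x] must go to
    [P_Y] applied [n] times to [f x] ([free_opset_ext]).  Conversely this
    formula does define an operated map ([free_lift]), because the level of an
    element, hence the number of times [P_Y] is applied, is part of the data of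
    the disjoint union.  Restriction along the inclusion of [X] is therefore a
    bijection from operated maps out of the bracketed set to maps out of [X].
    This is the universal property, and it is also the adjunction bijection;
    restriction is natural because on level [0] the functor acts by [f] itself. *)

Fixpoint bracket_eval (X : Type) (Y : opset) (f : X -> Y) (n : nat) :
    bracket_iter n X -> Y :=
  if n is m.+1
  then fun u => let: Bracket v := u in op Y (bracket_eval f v)
  else f.

Lemma bracket_evalP (X : Type) (Y : opset) (f : X -> Y) :
  {morph (fun u : free_opset X => bracket_eval f (projT2 u)) :
     u / op (free_opset X) u >-> op Y u}.
Proof. by []. Qed.

Definition free_lift (X : Type) (Y : opset) (f : X -> Y) :
  opmor (free_opset X) Y := OpMor (bracket_evalP f).

Lemma free_lift_incl (X : Type) (Y : opset) (f : X -> Y) :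
  free_lift f \o @free_incl X = f.
Proof. by []. Qed.

(** The elements of level [0] generate the bracketed set under its operator,
    so the set where two operated maps agree is everything as soon as it
    contains them. *)
Lemma free_opset_ext (X : Type) (Y : opset) (g h : opmor (free_opset X) Y) :
  g \o @free_incl X = h \o @free_incl X -> g = h.
Proof.
move=> gh; apply: opmor_inj; apply: funext => -[n u].
elim: n u => [|n IHn] u; first exact: (congr1 (@^~ u) gh).
case: u => u.
(* A bracket at level [n.+1] is the operator applied at level [n]. *)
pose v : free_opset X := existT (fun n => bracket_iter n X) n u.
by rewrite -[existT _ _ _]/(op (free_opset X) v) !opmorP IHn.
Qed.

Lemma free_lift_restrict (X : Type) (Y : opset) (g : opmor (free_opset X) Y) :
  free_lift (g \o @free_incl X) = g.
Proof. exact/free_opset_ext/free_lift_incl. Qed.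

Lemma free_opset_is_free (X : Type) : is_free_opset (@free_incl X).
Proof.
move=> Y f; exists (free_lift f); split=> [|g <-]; first exact: free_lift_incl.
exact: free_lift_restrict.
Qed.

Theorem proposition2p1 :
  left_adjoint F_OpSet U_OpSet /\
  (forall X : Type, is_free_opset (@free_incl X)).
Proof.
split; last exact: free_opset_is_free.
exists (fun (X : SetCat) (Y : OpSetCat) (k : opmor (free_opset X) Y) =>
  k \o @free_incl X).
split=> [X Y|//].
exists (@free_lift X Y); [exact: free_lift_restrict | exact: free_lift_incl].
Qed.
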